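(* Let $\Sigma\in\mathbb{R}^{n\times n}$ be symmetric positive definite, $K\in\mathbb{R}^{n\times r}$, $A\in\mathbb{R}^{m\times n}$ with rows $a_1^T,\dots,a_m^T$, and $\sigma_N^2>0$. For $X\in\mathbb{R}^{r\times m}$ with columns $x_1,\dots,x_m\in\mathbb{R}^r$, let $$F(X)=\|(XA-K^T)\Sigma^{1/2}\|_F^2+\sigma_N^2\Big(\sum_{i=1}^m\|x_i\|\Big)^2,\qquad \rho=\min_{X\in\mathbb{R}^{r\times m}}F(X).$$ Let $X_0\in\mathbb{R}^{r\times m}$ be arbitrary and let $(X_k)_{k\ge0}$ be produced by the alternating minimization algorithm applied to the minimization of $F$, with blocks (columns) taken in a cyclic order or using random permutations. Then the sequence of objective values $(F(X_k))_{k\ge0}$ is nonincreasing and $F(X_k)\to\rho$ as $k\to\infty$.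
   Context: $\|\cdot\|$ is the Euclidean norm, $\|\cdot\|_F$ the Frobenius norm, $\Sigma^{1/2}$ the symmetric positive definite square root of $\Sigma$. Alternating minimization algorithm: given $X_{k-1}$ with columns $x_{1(k-1)},\dots,x_{m(k-1)}$, at iteration $k=1,2,\dots$ an index $i=i_k\in\{1,\dots,m\}$ is chosen; $x_{jk}=x_{j(k-1)}$ for all $j\ne i$; and the $i$th column is replaced by the minimizer of $F$ with respect to the $i$th column with all other columns fixed, namely, with $R:=\sum_{j\ne i}x_{j(k-1)}a_j^T-K^T$ and $\beta:=\sum_{j\ne i}\|x_{j(k-1)}\|$, by $$x_{ik}=-\frac{1}{a_i^T\Sigma a_i+\sigma_N^2}\max\Big\{1-\sigma_N^2\frac{\beta}{\|R\Sigma a_i\|},0\Big\}R\Sigma a_i$$ if $R\Sigma a_i\neq0$, and $x_{ik}=0$ if $R\Sigma a_i=0$. $X_k$ is the matrix with columns $x_{1k},\dots,x_{mk}$. Choice of indices: ''cyclic order'' means the indices $1,\dots,m$ are visited periodically in a fixed order; ''random permutations'' means that for each successive group of $m$ iterations a new permutation of $\{1,\dots,m\}$ is drawn at random and the indices are visited in the order of that permutation (so in each such group every index is visited exactly once); the conclusion is understood for the sequence produced by any realization of these permutations. *)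

(* Defs.v *)
From mathcomp Require Import all_boot all_order perm all_algebra.
From mathcomp Require Import classical_sets reals topology normedtype sequences.

Set Implicit Arguments.
Unset Strict Implicit.
Unset Printing Implicit Defensive.

Import Order.TTheory GRing.Theory Num.Theory.
Import numFieldNormedType.Exports.

Local Open Scope classical_set_scope.
Local Open Scope ring_scope.

(* The library norm `|_| on matrices is the sup norm; hence the two
   definitions below. *)
Definition enorm (R : realType) (d : nat) (x : 'cV[R]_d) : R :=
  Num.sqrt (\sum_(l < d) x l 0 ^+ 2).

Definition fnorm (R : realType) (p q : nat) (M : 'M[R]_(p, q)) : R :=
  Num.sqrt (\sum_(i < p) \sum_(j < q) M i j ^+ 2).

Definition spd (R : realType) (n : nat) (S : 'M[R]_n) : Prop :=
  S^T = S /\ forall x : 'cV[R]_n, x != 0 -> 0 < (x^T *m S *m x) 0 0.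

(* Sigma^{1/2}: for Sigma symmetric positive definite, exactly one matrix
   satisfies this predicate, so the default value 0 is not used. *)
Definition sqrtm (R : realType) (n : nat) (Sigma : 'M[R]_n) : 'M[R]_n :=
  xget 0 [set S : 'M[R]_n | spd S /\ S *m S = Sigma].

Definition F (R : realType) (n r m : nat) (Sigma : 'M[R]_n) (K : 'M[R]_(n, r))
    (A : 'M[R]_(m, n)) (sigmaN : R) (X : 'M[R]_(r, m)) : R :=
  fnorm ((X *m A - K^T) *m sqrtm Sigma) ^+ 2
  + sigmaN ^+ 2 * (\sum_(i < m) enorm (col i X)) ^+ 2.

Definition is_min (R : realType) (T : Type) (f : T -> R) (rho : R) : Prop :=
  (exists x, f x = rho) /\ forall x, rho <= f x.

(* New value of column i. The vector a_i is the transpose of row i of A, so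
   that a_i^T is row i A. *)
Definition am_column (R : realType) (n r m : nat) (Sigma : 'M[R]_n)
    (K : 'M[R]_(n, r)) (A : 'M[R]_(m, n)) (sigmaN : R) (i : 'I_m)
    (X : 'M[R]_(r, m)) : 'cV[R]_r :=
  let a := (row i A)^T in
  let resid := \sum_(j < m | j != i) col j X *m row j A - K^T in
  let beta := \sum_(j < m | j != i) enorm (col j X) in
  let g := resid *m Sigma *m a in
  if g == 0 then 0
  else - (((a^T *m Sigma *m a) 0 0 + sigmaN ^+ 2)^-1
          * Num.max (1 - sigmaN ^+ 2 * (beta / enorm g)) 0) *: g.

Definition am_step (R : realType) (n r m : nat) (Sigma : 'M[R]_n)
    (K : 'M[R]_(n, r)) (A : 'M[R]_(m, n)) (sigmaN : R) (i : 'I_m)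
    (X : 'M[R]_(r, m)) : 'M[R]_(r, m) :=
  \matrix_(l < r, j < m)
    if j == i then am_column Sigma K A sigmaN i X l 0 else X l j.

(* idx k is the index i_{k+1} used to pass from X_k to X_{k+1}. *)
Fixpoint am_iter (R : realType) (n r m : nat) (Sigma : 'M[R]_n)
    (K : 'M[R]_(n, r)) (A : 'M[R]_(m, n)) (sigmaN : R) (idx : nat -> 'I_m)
    (X0 : 'M[R]_(r, m)) (k : nat) : 'M[R]_(r, m) :=
  if k is k'.+1
  then am_step Sigma K A sigmaN (idx k')
         (am_iter Sigma K A sigmaN idx X0 k')
  else X0.

Definition cyclic_order (m : nat) (idx : nat -> 'I_m) : Prop :=
  exists p : 'S_m, forall (q : nat) (j : 'I_m), idx (q * m + j)%N = p j.

(* Realizations of the random choice: p q is the permutation drawn for the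
   q-th group of m iterations. *)
Definition permutation_order (m : nat) (idx : nat -> 'I_m) : Prop :=
  exists p : nat -> 'S_m,
    forall (q : nat) (j : 'I_m), idx (q * m + j)%N = p q j.

(* Main.v *)
Require Import Defs.
From mathcomp Require Import all_boot all_order perm all_algebra.
From mathcomp Require Import spectral sesquilinear complex.
From mathcomp Require Import ring lra zify.
From mathcomp Require Import boolp classical_sets reals topology.
From mathcomp Require Import normedtype sequences derive realfun.
Import Order.TTheory GRing.Theory Num.Theory.
Import numFieldNormedType.Exports.
Local Open Scope classical_set_scope.
Local Open Scope ring_scope.

(** Write [c] for [sigmaN ^+ 2], [T X] for the sum of the Euclidean norms of
    the columns of [X], and [G X] for half the gradient of the quadratic part
    of [F], so that [G X = (X A - K^T) Sigma A^T].

    The penalty [T ^+ 2] is not separable over the columns, so the general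
    convergence theorems for block coordinate descent do not apply directly.
    What saves the argument is that its subdifferential at [X] is nevertheless
    of product form: it consists of the tuples [2 T(X) u_i] with [u_i] a
    subgradient of the Euclidean norm at the [i]th column.  The closed formula
    for the column update is exactly the solution of
    [col i (G X) + c T(X) u_i = 0] ([am_step_optimal]), which is the [i]th
    component of the condition for a global minimum.

    Two consequences of convexity are used.  First, a step that moves the
    iterate by [D] lowers [F] by at least [c T(D) ^+ 2] ([F_block_descent]);
    hence the values decrease, the iterates stay in a sublevel set, on which
    [T] is bounded, and in a sweep of [m] steps that lowers [F] by [c d ^+ 2]
    every iterate is within [T]-distance [m d] of the last ([am_iter_drift]).
    Secondly, at the end of a sweep every column has been updated once, so each
    equation [col i (G X) + c T(X) u_i = 0] held exactly at some point of the
    sweep, with the same [i]th column and hence with the same [u_i].  As [G] and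
    [T] are Lipschitz, it still holds up to an error of order [d] at the end,
    and the subgradient inequality then bounds the distance of [F] to its
    minimum by a constant times [d] ([sweep_gap]).

    Thus the squared gap after a sweep is at most a constant times the decrease
    during that sweep.  The decreases tend to [0] because the values converge,
    and so does the gap ([cvg_of_sweep_decrease]).  The minimum is attained
    because sublevel sets are compact ([F_attains_min]).

    The objective is defined through the square root of [Sigma], so the
    existence of that root has to be established as well ([spd_sqrt_exists]);
    it turns the quadratic part of [F] into a trace. *)

Set Implicit Arguments.
Unset Strict Implicit.

(** * Square roots of positive definite matrices *)

(** The complex spectral theorem makes [S] similar to a diagonal matrix with
    real entries; two real matrices that are similar over the complex numbers
    are similar over the reals.  The rows of [Q] are left eigenvectors.  [Q] need
    not be orthogonal, which [spectral_function_sym] makes up for. *)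
Lemma sym_diagonalizable (R : realType) (n : nat) (S : 'M[R]_n) :
  S^T = S ->
  exists Q : 'M[R]_n, exists d : 'rV[R]_n,
    Q \in unitmx /\ Q *m S = diag_mx d *m Q.
Proof.
move=> symS.
pose toC := real_complex R.
have realM p q (M : 'M[R]_(p, q)) : map_mx toC M \is a realmx.
  by apply/mxOverP => i j; rewrite mxE; apply/complex_realP; exists (M i j).
have realE p q (M : 'M[R[i]]_(p, q)) :
    M \is a realmx -> exists M0, M = map_mx toC M0.
  move=> /mxOverP rM; exists (map_mx (@complex.Re R) M).
  by apply/matrixP => i j; rewrite !mxE /toC RRe_real.
pose SC := map_mx toC S.
have symSC : SC \is symmetricmx.
  apply/is_hermitianmxP.
  rewrite expr0 scale1r map_mx_id //; apply/matrixP => i j.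
  by rewrite !mxE -[in LHS]symS mxE.
have hSC := realsym_hermsym symSC (realM _ _ S).
have /realE[d dE] := hermitian_spectral_diag_real hSC.
have /orthomx_spectralP := hermitian_normalmx hSC.
rewrite dE -map_diag_mx.
have := spectral_unit SC; move: (spectralmx SC) => P uP SE.
have sim : similar_in unitmx SC (map_mx toC (diag_mx d)).
  exists P => //; apply/similarP => //.
  by rewrite SE !mulmxA mulmxV // mul1mx.
have [P' /andP[/realE[Q ->] uQ] /similarP-/(_ uQ)] :=
  real_similar sim (realM _ _ _) (realM _ _ _).
rewrite -!map_mxM => /map_mx_inj eqQ.
exists Q, d; split=> //; by rewrite map_unitmx in uQ.
Qed.

Lemma dotxx_ge0 (R : realType) (d : nat) (x : 'cV[R]_d) :
  0 <= (x^T *m x) 0 0.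
Proof. by rewrite mxE; apply: sumr_ge0 => l _; rewrite mxE -expr2 sqr_ge0. Qed.

Lemma dotxx_eq0 (R : realType) (d : nat) (x : 'cV[R]_d) :
  (x^T *m x) 0 0 = 0 -> x = 0.
Proof.
rewrite mxE => /eqP; rewrite psumr_eq0; last first.
  by move=> l _; rewrite mxE -expr2 sqr_ge0.
move=> /allP x0; apply/colP => l; rewrite mxE; apply/eqP.
by have := x0 l (mem_index_enum _); rewrite mxE -expr2 sqrf_eq0.
Qed.

Lemma spd_eigenvalue_gt0 (R : realType) (n : nat) (S Q : 'M[R]_n)
    (d : 'rV[R]_n) (i : 'I_n) :
  spd S -> Q \in unitmx -> Q *m S = diag_mx d *m Q -> 0 < d 0 i.
Proof.
move=> [_ posS] uQ QS; pose v := (row i Q)^T.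
have v0 : v != 0.
  apply/eqP => /(congr1 trmx); rewrite trmxK trmx0 rowE.
  move=> /(congr1 (mulmx^~ (invmx Q))).
  rewrite mulmxK // mul0mx => /rowP/(_ i); rewrite !mxE !eqxx => /eqP.
  by rewrite oner_eq0.
have := posS v v0; rewrite /v trmxK -row_mul QS row_mul row_diag_mx.
rewrite -scalemxAl -rowE -scalemxAl mxE; have := dotxx_ge0 v; rewrite /v trmxK.
move=> vv; rewrite !ltNge; apply: contra => d0.
by rewrite mulr_le0_ge0.
Qed.

(** Although [Q] is not orthogonal, the Gram matrix [Q Q^T] commutes with
    [diag_mx d] because [S] is symmetric.  Entrywise this says that it vanishes
    where [d i <> d j], so it commutes with every function of [diag_mx d], and
    this gives back the symmetry of the corresponding function of [S]. *)
Lemma spectral_function_sym (R : realType) (n : nat) (S Q : 'M[R]_n)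
    (d : 'rV[R]_n) (f : R -> R) :
  S^T = S -> Q \in unitmx -> Q *m S = diag_mx d *m Q ->
  let T := invmx Q *m diag_mx (map_mx f d) *m Q in T^T = T.
Proof.
move=> symS uQ QS T; pose N := Q *m Q^T; pose Df := diag_mx (map_mx f d).
have symN : N^T = N by rewrite /N trmx_mul trmxK.
have QT : Q *m T = Df *m Q by rewrite /T !mulmxA mulmxV // mul1mx.
clearbody T.
have comm : diag_mx d *m N = N *m diag_mx d.
  rewrite -[RHS]trmxK trmx_mul tr_diag_mx symN /N mulmxA -QS -mulmxA.
  by rewrite !trmx_mul trmxK symS mulmxA.
have commf : Df *m N = N *m Df.
  apply/matrixP => i j; move/matrixP: comm => /(_ i j).
  rewrite !mul_diag_mx !mul_mx_diag !mxE.
  have [-> _|N0] := eqVneq (\sum_k Q i k * Q^T k j) 0.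
    by rewrite mul0r mulr0.
  by rewrite mulrC => /(mulfI N0) ->; rewrite mulrC.
have eqN : Q *m T^T *m Q^T = Q *m T *m Q^T.
  have -> : Q *m T^T *m Q^T = (Q *m T *m Q^T)^T.
    by rewrite !trmx_mul trmxK mulmxA.
  by rewrite QT -mulmxA -/N trmx_mul symN tr_diag_mx commf.
have uQT : Q^T \in unitmx by rewrite unitmx_tr.
have /(congr1 (mulmx (invmx Q))) := eqN.
move=> /(congr1 (mulmx^~ (invmx Q^T))); rewrite -!mulmxA mulmxV // !mulmx1.
by rewrite !mulKmx.
Qed.

(** The root [T] is itself the square of the symmetric fourth root [U], so its
    quadratic form is [x |-> |U x|^2]; it is definite because [U x = 0] would
    give [S x = 0]. *)
Lemma spd_sqrt_exists (R : realType) (n : nat) (S : 'M[R]_n) :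
  spd S -> exists T : 'M[R]_n, spd T /\ T *m T = S.
Proof.
move=> spdS; have [symS posS] := spdS.
have [Q [d [uQ QS]]] := sym_diagonalizable symS.
have d_gt0 i := spd_eigenvalue_gt0 i spdS uQ QS.
pose fS f := invmx Q *m diag_mx (map_mx f d) *m Q.
have fS_sym f : (fS f)^T = fS f := spectral_function_sym f symS uQ QS.
have fS_mul f g h : (forall i, f (d 0 i) * f (d 0 i) = g (d 0 i)) -> h = g ->
    fS f *m fS f = fS h.
  move=> fg ->; rewrite /fS !mulmxA mulmxK // -!mulmxA; congr (_ *m _).
  rewrite !mulmxA; congr (_ *m _); rewrite mulmx_diag; congr diag_mx.
  by apply/rowP => j; rewrite !mxE fg.
pose T := fS Num.sqrt; pose U := fS (Num.sqrt \o Num.sqrt).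
have TT : T *m T = S.
  rewrite (fS_mul _ id id) // => [|i]; last by rewrite -expr2 sqr_sqrtr // ltW.
  have -> : fS id = invmx Q *m (Q *m S) by rewrite QS mulmxA /fS map_mx_id.
  by rewrite mulKmx.
have UU : U *m U = T.
  by apply: fS_mul (erefl _) => i /=; rewrite -expr2 sqr_sqrtr // sqrtr_ge0.
exists T; split=> //; split=> [|x x0]; first exact: fS_sym.
have -> : x^T *m T *m x = (U *m x)^T *m (U *m x).
  by rewrite trmx_mul fS_sym -UU !mulmxA.
rewrite lt_def dotxx_ge0 andbT; apply: contraTneq (posS x x0).
move=> /dotxx_eq0 Ux.
have -> : x^T *m S *m x = x^T *m U *m U *m U *m (U *m x).
  by rewrite -TT -UU !mulmxA.
by rewrite Ux mulmx0 mxE ltxx.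
Qed.

(** * The Euclidean norm and its subgradients *)

Definition dot (R : realType) (d : nat) (u v : 'cV[R]_d) : R := (u^T *m v) 0 0.

Lemma dotC (R : realType) (d : nat) (u v : 'cV[R]_d) : dot u v = dot v u.
Proof. by rewrite /dot -[in LHS](trmxK v) -trmx_mul mxE. Qed.

Lemma dotDl (R : realType) (d : nat) (u v w : 'cV[R]_d) :
  dot (u + v) w = dot u w + dot v w.
Proof. by rewrite /dot linearD mulmxDl mxE. Qed.

Lemma dotZl (R : realType) (d : nat) (a : R) (u w : 'cV[R]_d) :
  dot (a *: u) w = a * dot u w.
Proof. by rewrite /dot linearZ -scalemxAl mxE. Qed.

Lemma dotDr (R : realType) (d : nat) (u v w : 'cV[R]_d) :
  dot w (u + v) = dot w u + dot w v.
Proof. by rewrite !(dotC w) dotDl. Qed.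

Lemma dotZr (R : realType) (d : nat) (a : R) (u w : 'cV[R]_d) :
  dot w (a *: u) = a * dot w u.
Proof. by rewrite !(dotC w) dotZl. Qed.

Lemma dotBr (R : realType) (d : nat) (u v w : 'cV[R]_d) :
  dot w (u - v) = dot w u - dot w v.
Proof. by rewrite dotDr -scaleN1r dotZr mulN1r. Qed.

Lemma dotBl (R : realType) (d : nat) (u v w : 'cV[R]_d) :
  dot (u - v) w = dot u w - dot v w.
Proof. by rewrite !(dotC _ w) dotBr. Qed.

Lemma enorm_ge0 (R : realType) (d : nat) (x : 'cV[R]_d) : 0 <= enorm x.
Proof. exact: sqrtr_ge0. Qed.

Lemma sqr_enorm (R : realType) (d : nat) (x : 'cV[R]_d) :
  enorm x ^+ 2 = dot x x.
Proof.
rewrite /enorm sqr_sqrtr; last by apply: sumr_ge0 => l _; exact: sqr_ge0.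
by rewrite /dot mxE; apply: eq_bigr => l _; rewrite mxE expr2.
Qed.

Lemma enorm_eq0 (R : realType) (d : nat) (x : 'cV[R]_d) :
  (enorm x == 0) = (x == 0).
Proof.
rewrite -sqrf_eq0 sqr_enorm; apply/eqP/eqP => [|->]; first exact: dotxx_eq0.
by rewrite /dot mulmx0 mxE.
Qed.

Lemma enorm0 (R : realType) (d : nat) : enorm (0 : 'cV[R]_d) = 0.
Proof. by apply/eqP; rewrite enorm_eq0. Qed.

Lemma enormZ (R : realType) (d : nat) (a : R) (x : 'cV[R]_d) :
  enorm (a *: x) = `|a| * enorm x.
Proof.
apply: (pexpIrn (n := 2)); rewrite ?nnegrE ?mulr_ge0 ?enorm_ge0 //.
by rewrite exprMn !sqr_enorm dotZl dotZr real_normK ?num_real // mulrA -expr2.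
Qed.

Lemma enormN (R : realType) (d : nat) (x : 'cV[R]_d) : enorm (- x) = enorm x.
Proof. by rewrite -scaleN1r enormZ normrN1 mul1r. Qed.

Lemma dot_le_enorm (R : realType) (d : nat) (u v : 'cV[R]_d) :
  dot u v <= enorm u * enorm v.
Proof.
have [->|u0] := eqVneq u 0.
  by rewrite enorm0 mul0r /dot trmx0 mul0mx mxE.
have [->|v0] := eqVneq v 0.
  by rewrite enorm0 mulr0 /dot mulmx0 mxE.
have uv : 0 < enorm u * enorm v.
  by rewrite mulr_gt0 // lt_def enorm_ge0 enorm_eq0 ?u0 ?v0.
have := sqr_ge0 (enorm (enorm v *: u - enorm u *: v)).
rewrite sqr_enorm dotBl !dotBr !dotZl !dotZr -!sqr_enorm (dotC v u) => h.
rewrite -subr_ge0 -(pmulr_rge0 _ uv); lra.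
Qed.

Lemma enormD (R : realType) (d : nat) (u v : 'cV[R]_d) :
  enorm (u + v) <= enorm u + enorm v.
Proof.
rewrite -(ler_pXn2r (n := 2)) ?nnegrE ?addr_ge0 ?enorm_ge0 //.
rewrite sqr_enorm dotDl !dotDr (dotC v u) -!sqr_enorm.
have := dot_le_enorm u v; lra.
Qed.

Lemma coord_le_enorm (R : realType) (d : nat) (x : 'cV[R]_d) l :
  `|x l 0| <= enorm x.
Proof.
rewrite -(ler_pXn2r (n := 2)) ?nnegrE ?enorm_ge0 // real_normK ?num_real //.
rewrite sqr_enorm /dot mxE (bigD1 l) //= mxE -expr2 lerDl.
by apply: sumr_ge0 => k _; rewrite mxE -expr2 sqr_ge0.
Qed.

Lemma enorm_sum (R : realType) (d : nat) (I : finType) (f : I -> 'cV[R]_d) :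
  enorm (\sum_i f i) <= \sum_i enorm (f i).
Proof.
elim/big_ind2: _ => [|a x b y xa yb|//]; first by rewrite enorm0.
exact: le_trans (enormD _ _) (lerD xa yb).
Qed.

(** The subgradients [u] of the Euclidean norm at [x]: [u] is [x / |x|] if
    [x <> 0] and any vector of the unit ball if [x = 0].  Writing this as one
    equation avoids the case distinction in the inequalities below. *)
Definition subgrad (R : realType) (d : nat) (u x : 'cV[R]_d) : Prop :=
  enorm u <= 1 /\ x = enorm x *: u.

Lemma dot_subgrad (R : realType) (d : nat) (u x : 'cV[R]_d) :
  subgrad u x -> dot u x = enorm x.
Proof.
move=> [_ xu]; have [->|x0] := eqVneq x 0.
  by rewrite enorm0 /dot mulmx0 mxE.
apply: (mulfI (x := enorm x)); first by rewrite enorm_eq0.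
by rewrite -dotZl -xu -expr2 sqr_enorm.
Qed.

Lemma subgrad_dot_le (R : realType) (d : nat) (u x z : 'cV[R]_d) :
  subgrad u x -> dot u z <= enorm z.
Proof.
move=> [u1 _]; apply: le_trans (dot_le_enorm _ _) _.
by rewrite ler_piMl ?enorm_ge0.
Qed.

Definition colsum (R : realType) (r m : nat) (X : 'M[R]_(r, m)) : R :=
  \sum_(i < m) enorm (col i X).

Lemma colsum_ge0 (R : realType) (r m : nat) (X : 'M[R]_(r, m)) : 0 <= colsum X.
Proof. by apply: sumr_ge0 => i _; exact: enorm_ge0. Qed.

Lemma colsumD (R : realType) (r m : nat) (X Y : 'M[R]_(r, m)) :
  colsum (X + Y) <= colsum X + colsum Y.
Proof.
rewrite /colsum -big_split; apply: ler_sum => i _.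
by rewrite linearD /=; exact: enormD.
Qed.

Lemma colsumN (R : realType) (r m : nat) (X : 'M[R]_(r, m)) :
  colsum (- X) = colsum X.
Proof. by apply: eq_bigr => i _; rewrite linearN enormN. Qed.

Lemma colsum_dist (R : realType) (r m : nat) (X Y : 'M[R]_(r, m)) :
  `|colsum X - colsum Y| <= colsum (X - Y).
Proof.
rewrite ler_norml; apply/andP; split; last first.
  by rewrite lerBlDr; apply: le_trans (colsumD _ _); rewrite subrK.
rewrite lerBrDl lerBlDr -(colsumN (X - Y)) opprB.
by apply: le_trans (colsumD _ _); rewrite addrC subrK.
Qed.

Lemma colsumD1 (R : realType) (r m : nat) (X : 'M[R]_(r, m)) (i : 'I_m) :
  colsum X = enorm (col i X) + \sum_(j < m | j != i) enorm (col j X).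
Proof. by rewrite /colsum (bigD1 i). Qed.

(** The constant is the crudest one: all that matters is that right
    multiplication by a fixed matrix is Lipschitz, uniformly over columns. *)
Lemma enorm_col_mul (R : realType) (r m p : nat) (X : 'M[R]_(r, m))
    (B : 'M[R]_(m, p)) (i : 'I_p) :
  enorm (col i (X *m B)) <= (\sum_k \sum_j `|B k j|) * colsum X.
Proof.
have -> : col i (X *m B) = \sum_k B k i *: col k X.
  apply/colP => l; rewrite !mxE summxE; apply: eq_bigr => k _.
  by rewrite !mxE mulrC.
apply: le_trans (enorm_sum _) _; rewrite /colsum mulr_sumr; apply: ler_sum => k _.
rewrite enormZ ler_wpM2r ?enorm_ge0 // (bigD1 k) //= (bigD1 i) //= -addrA.
by rewrite lerDl addr_ge0 ?sumr_ge0 // => j _; rewrite sumr_ge0.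
Qed.

(** * Convexity of the objective and optimality of the column update *)

Lemma sqrtmP (R : realType) (n : nat) (S : 'M[R]_n) :
  spd S -> spd (sqrtm S) /\ sqrtm S *m sqrtm S = S.
Proof.
move=> /spd_sqrt_exists ex.
exact: (@xgetPex _ 0 [set T | spd T /\ T *m T = S] ex). Qed.

Definition wdot (R : realType) (r n : nat) (S : 'M[R]_n)
    (M N : 'M[R]_(r, n)) : R :=
  \tr (M *m S *m N^T).

(** This removes the square root of [Sigma] from the objective, leaving an
    expression that is quadratic in [M] with explicit coefficients. *)
Lemma fnorm_sqrtm (R : realType) (r n : nat) (S : 'M[R]_n) (M : 'M[R]_(r, n)) :
  spd S -> fnorm (M *m sqrtm S) ^+ 2 = wdot S M M.
Proof.
move=> /sqrtmP[[symT _] TT]; rewrite /fnorm sqr_sqrtr; last first.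
  by apply: sumr_ge0 => i _; apply: sumr_ge0 => j _; exact: sqr_ge0.
have -> : wdot S M M = \tr ((M *m sqrtm S) *m (M *m sqrtm S)^T).
  by rewrite /wdot trmx_mul symT -{1}TT !mulmxA.
apply: eq_bigr => i _; rewrite mxE; apply: eq_bigr => j _.
by rewrite [X in _ = _ * X]mxE -expr2.
Qed.

Lemma wdot_ge0 (R : realType) (r n : nat) (S : 'M[R]_n) (M : 'M[R]_(r, n)) :
  spd S -> 0 <= wdot S M M.
Proof. by move=> /fnorm_sqrtm <-; exact: sqr_ge0. Qed.

Lemma wdotDD (R : realType) (r n : nat) (S : 'M[R]_n) (M N : 'M[R]_(r, n)) :
  S^T = S -> wdot S (M + N) (M + N) = wdot S M M + 2 * wdot S M N + wdot S N N.
Proof.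
move=> symS.
have C : wdot S N M = wdot S M N.
  by rewrite /wdot -mxtrace_tr !trmx_mul trmxK symS mulmxA.
rewrite /wdot linearD /= !mulmxDl !mulmxDr !linearD /=.
rewrite -/(wdot S N M) -/(wdot S M N) C; ring.
Qed.

(** Half the gradient of the quadratic part of the objective. *)
Definition halfgrad (R : realType) (n r m : nat) (Sigma : 'M[R]_n)
    (K : 'M[R]_(n, r)) (A : 'M[R]_(m, n)) (X : 'M[R]_(r, m)) : 'M[R]_(r, m) :=
  (X *m A - K^T) *m Sigma *m A^T.

Lemma wdot_halfgrad (R : realType) (n r m : nat) (Sigma : 'M[R]_n)
    (K : 'M[R]_(n, r)) (A : 'M[R]_(m, n)) (X W : 'M[R]_(r, m)) :
  wdot Sigma (X *m A - K^T) (W *m A)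
  = \sum_i dot (col i (halfgrad Sigma K A X)) (col i W).
Proof.
rewrite /wdot trmx_mul mulmxA -/(halfgrad Sigma K A X) mxtrace_mulC.
apply: eq_bigr => i _; rewrite /dot !mxE; apply: eq_bigr => l _.
by rewrite !mxE mulrC.
Qed.

Lemma F_wdot (R : realType) (n r m : nat) (Sigma : 'M[R]_n)
    (K : 'M[R]_(n, r)) (A : 'M[R]_(m, n)) (s : R) (X : 'M[R]_(r, m)) :
  spd Sigma ->
  F Sigma K A s X
  = wdot Sigma (X *m A - K^T) (X *m A - K^T) + s ^+ 2 * colsum X ^+ 2.
Proof. by move=> hS; rewrite /F fnorm_sqrtm. Qed.

(** The quadratic part is expanded exactly around [X], and its second-order
    term, which is nonnegative, is dropped. *)
Lemma F_expand (R : realType) (n r m : nat) (Sigma : 'M[R]_n)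
    (K : 'M[R]_(n, r)) (A : 'M[R]_(m, n)) (s : R) (X Z : 'M[R]_(r, m)) :
  spd Sigma ->
  F Sigma K A s X
  + 2 * \sum_i dot (col i (halfgrad Sigma K A X)) (col i (Z - X))
  + s ^+ 2 * (colsum Z ^+ 2 - colsum X ^+ 2) <= F Sigma K A s Z.
Proof.
move=> hS; rewrite !F_wdot //.
have -> : Z *m A - K^T = (X *m A - K^T) + (Z - X) *m A.
  by rewrite mulmxBl [RHS]addrC addrA subrK.
rewrite (wdotDD (X *m A - K^T) _ hS.1) wdot_halfgrad.
have := wdot_ge0 ((Z - X) *m A) hS; lra.
Qed.

(** The penalty is the square of the nonnegative convex function [colsum], so
    it lies above its linearization
    [colsum X ^+ 2 + 2 colsum X (colsum Z - colsum X)], and the second factor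
    is bounded below columnwise by the subgradients. *)
Lemma F_subgradient_ineq (R : realType) (n r m : nat) (Sigma : 'M[R]_n)
    (K : 'M[R]_(n, r)) (A : 'M[R]_(m, n)) (s : R) (X Z : 'M[R]_(r, m))
    (u : 'I_m -> 'cV[R]_r) :
  spd Sigma -> (forall i, subgrad (u i) (col i X)) ->
  F Sigma K A s X
  + 2 * \sum_i dot (col i (halfgrad Sigma K A X) + (s ^+ 2 * colsum X) *: u i)
                   (col i (Z - X)) <= F Sigma K A s Z.
Proof.
move=> hS hu; apply: le_trans (F_expand K A s X Z hS).
under eq_bigr do rewrite dotDl dotZl.
rewrite big_split /= -mulr_sumr mulrDr addrA lerD2l mulrCA.
have sub : \sum_i dot (u i) (col i (Z - X)) <= colsum Z - colsum X.
  rewrite /colsum -sumrB; apply: ler_sum => i _.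
  rewrite linearB /= dotBr (dot_subgrad (hu i)) lerD2r.
  exact: (subgrad_dot_le _ (hu i)).
rewrite -(mulrA (s ^+ 2)) ler_wpM2l ?sqr_ge0 //.
have := ler_wpM2l (colsum_ge0 X) sub; have := sqr_ge0 (colsum Z - colsum X).
lra.
Qed.

(** The gain comes from the penalty alone: with [p], [q] the norms of the
    [i]th columns of [X] and [Y], and [b] the common norm sum of the other
    columns, the optimality condition reduces the claim to
    [0 <= 2 b (q - dot u (col i Y))].  It is therefore the same for all
    columns, even where [a_i = 0] makes the quadratic part flat. *)
Lemma F_block_descent (R : realType) (n r m : nat) (Sigma : 'M[R]_n)
    (K : 'M[R]_(n, r)) (A : 'M[R]_(m, n)) (s : R) (X Y : 'M[R]_(r, m))
    (i : 'I_m) (u : 'cV[R]_r) :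
  spd Sigma -> (forall j, j != i -> col j Y = col j X) ->
  subgrad u (col i X) ->
  col i (halfgrad Sigma K A X) + (s ^+ 2 * colsum X) *: u = 0 ->
  F Sigma K A s X + s ^+ 2 * colsum (Y - X) ^+ 2 <= F Sigma K A s Y.
Proof.
move=> hS YX hu /eqP; rewrite addr_eq0 => /eqP opt.
apply: le_trans (F_expand K A s X Y hS).
have YX0 j : j != i -> col j (Y - X) = 0.
  by move=> ji; rewrite linearB /= YX // subrr.
rewrite (bigD1 i) //= big1 => [|j ji]; last by rewrite YX0 // /dot mulmx0 mxE.
rewrite addr0 opt -scaleNr dotZl linearB /= dotBr (dot_subgrad hu).
have -> : colsum (Y - X) = enorm (col i Y - col i X).
  rewrite (colsumD1 _ i) linearB /= big1 ?addr0 // => j ji.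
  by rewrite YX0 // enorm0.
rewrite sqr_enorm dotBl !dotBr -!sqr_enorm.
rewrite (dotC (col i Y)).
have -> : dot (col i X) (col i Y) = enorm (col i X) * dot u (col i Y).
  by rewrite {1}hu.2 dotZl.
rewrite (colsumD1 X i) (colsumD1 Y i).
have -> : \sum_(j < m | j != i) enorm (col j Y)
          = \sum_(j < m | j != i) enorm (col j X).
  by apply: eq_bigr => j ji; rewrite YX.
have := subgrad_dot_le (col i Y) hu.
have : 0 <= \sum_(j < m | j != i) enorm (col j X).
  by apply: sumr_ge0 => j _; exact: enorm_ge0.
move: (\sum_(j < m | _) _) (dot u _) (enorm (col i X)) (enorm (col i Y)).
move=> b d p q b0 dq; rewrite -(addrA (F Sigma K A s X)) lerD2l -subr_ge0.
have -> : 2 * (- (s ^+ 2 * (p + b)) * (d - p)) +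
   s ^+ 2 * ((q + b) ^+ 2 - (p + b) ^+ 2) -
   s ^+ 2 * (q ^+ 2 - p * d - (p * d - p ^+ 2)) = s ^+ 2 * (2 * (b * (q - d))).
  ring.
by rewrite mulr_ge0 ?sqr_ge0 // mulr_ge0 // mulr_ge0 // subr_ge0.
Qed.

Lemma col_am_step (R : realType) (n r m : nat) (Sigma : 'M[R]_n)
    (K : 'M[R]_(n, r)) (A : 'M[R]_(m, n)) (s : R) (i j : 'I_m)
    (Y : 'M[R]_(r, m)) :
  col j (am_step Sigma K A s i Y)
  = if j == i then am_column Sigma K A s i Y else col j Y.
Proof. by apply/colP => l; rewrite !mxE; case: ifP => _; rewrite ?mxE. Qed.

(** If the shrinkage factor is positive, the new column is a negative multiple
    of [g] and [u = - g / |g|]; if it is zero, the new column is [0], where any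
    [u] of norm at most [1] is allowed, and the threshold says precisely that
    [- g / (c b)] is such a vector. *)
Lemma am_step_optimal (R : realType) (n r m : nat) (Sigma : 'M[R]_n)
    (K : 'M[R]_(n, r)) (A : 'M[R]_(m, n)) (s : R) (i : 'I_m)
    (Y : 'M[R]_(r, m)) (X := am_step Sigma K A s i Y) :
  spd Sigma -> 0 < s ^+ 2 ->
  exists2 u, subgrad u (col i X) &
    col i (halfgrad Sigma K A X) + (s ^+ 2 * colsum X) *: u = 0.
Proof.
move=> hS; set c := s ^+ 2 => c0.
have xi : col i X = am_column Sigma K A s i Y by rewrite col_am_step eqxx.
have xj j : j != i -> col j X = col j Y by rewrite col_am_step => /negbTE->.
pose a := (row i A)^T.
pose g := (\sum_(j < m | j != i) col j Y *m row j A - K^T) *m Sigma *m a.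
pose b := \sum_(j < m | j != i) enorm (col j Y).
pose t := (a^T *m Sigma *m a) 0 0.
have t0 : 0 <= t.
  rewrite /t; have [->|a0] := eqVneq a 0; first by rewrite mulmx0 mxE.
  by rewrite ltW //; exact: hS.2.
have b0 : 0 <= b by apply: sumr_ge0 => j _; exact: enorm_ge0.
have TX : colsum X = enorm (col i X) + b.
  by rewrite (colsumD1 _ i); congr (_ + _); apply: eq_bigr => j /xj ->.
have gX : col i (halfgrad Sigma K A X) = g + t *: col i X.
  have -> : col i (halfgrad Sigma K A X) = (X *m A - K^T) *m Sigma *m a.
    by rewrite /halfgrad colE -mulmxA /a tr_row colE.
  have -> : X *m A
            = col i X *m row i A + \sum_(j < m | j != i) col j Y *m row j A.
    have -> : X *m A = \sum_j col j X *m row j A.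
      apply/matrixP => k l; rewrite summxE mxE.
      by apply: eq_bigr => j _; rewrite !mxE big_ord1 !mxE.
    by rewrite (bigD1 i) //=; congr (_ + _); apply: eq_bigr => j /xj ->.
  rewrite -addrA mulmxDl mulmxDl [LHS]addrC; congr (_ + _).
  rewrite -(trmxK (row i A)) -/a -!mulmxA (mulmxA a^T).
  rewrite [X in _ *m X]mx11_scalar -/t.
  by rewrite mul_mx_scalar.
rewrite gX TX xi /am_column -/a -/g -/b -/t -/c.
have [g0|g0] := eqVneq g 0.
  exists 0; first by split; rewrite ?enorm0 ?ler01 // scale0r.
  by rewrite g0 !scaler0 !addr0.
have e0 : 0 < enorm g by rewrite lt_def enorm_ge0 enorm_eq0 g0.
have tc : t + c != 0 by rewrite gt_eqF // ltr_wpDl.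
case: (leP (1 - c * (b / enorm g)) 0) => h.
  rewrite mulr0 oppr0 scale0r.
  have bc : enorm g <= c * b.
    by move: h; rewrite subr_le0 mulrA ler_pdivlMr // mul1r.
  have bc0 : 0 < c * b by exact: lt_le_trans e0 bc.
  exists (- (c * b)^-1 *: g).
    split; last by rewrite enorm0 scale0r.
    by rewrite enormZ normrN gtr0_norm ?invr_gt0 // mulrC ler_pdivrMr // mul1r.
  rewrite enorm0 add0r scaler0 addr0 scalerA mulrN mulfV ?gt_eqF //.
  by rewrite scaleN1r subrr.
set h1 := 1 - _ in h *.
set q := _^-1 * h1.
have q0 : 0 < q by rewrite mulr_gt0 // invr_gt0 lt_def tc addr_ge0 // ltW.
have nq : enorm (- q *: g) = q * enorm g by rewrite enormZ normrN gtr0_norm.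
exists (- (enorm g)^-1 *: g).
  split; rewrite ?nq.
    by rewrite enormZ normrN gtr0_norm ?invr_gt0 // mulVf ?gt_eqF.
  by rewrite scalerA; congr (_ *: _); field; rewrite gt_eqF.
rewrite nq -[X in X + _ + _]scale1r !scalerA -!scalerDl.
suff -> : 1 + t * - q + c * (q * enorm g + b) * - (enorm g)^-1 = 0.
  by rewrite scale0r.
rewrite /q /h1; field.
by rewrite tc gt_eqF.
Qed.

(** * Decrease and optimality gap over one sweep *)

Lemma am_step_descent (R : realType) (n r m : nat) (Sigma : 'M[R]_n)
    (K : 'M[R]_(n, r)) (A : 'M[R]_(m, n)) (s : R) (i : 'I_m)
    (Y : 'M[R]_(r, m)) :
  spd Sigma -> 0 < s ^+ 2 ->
  F Sigma K A s (am_step Sigma K A s i Y)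
  + s ^+ 2 * colsum (Y - am_step Sigma K A s i Y) ^+ 2 <= F Sigma K A s Y.
Proof.
move=> hS c0; have [u hu opt] := am_step_optimal K A i Y hS c0.
apply: F_block_descent hS _ hu opt => j /negbTE ji.
by rewrite col_am_step ji.
Qed.

(** Coercivity of the objective: sublevel sets are bounded. *)
Lemma F_ge_colsum (R : realType) (n r m : nat) (Sigma : 'M[R]_n)
    (K : 'M[R]_(n, r)) (A : 'M[R]_(m, n)) (s : R) (X : 'M[R]_(r, m)) :
  s ^+ 2 * colsum X ^+ 2 <= F Sigma K A s X.
Proof. by rewrite /F lerDr sqr_ge0. Qed.

Lemma am_iter_nonincreasing (R : realType) (n r m : nat) (Sigma : 'M[R]_n)
    (K : 'M[R]_(n, r)) (A : 'M[R]_(m, n)) (s : R) (idx : nat -> 'I_m)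
    (X0 : 'M[R]_(r, m)) :
  spd Sigma -> 0 < s ^+ 2 ->
  nonincreasing_seq (fun k => F Sigma K A s (am_iter Sigma K A s idx X0 k)).
Proof.
move=> hS c0; apply/nonincreasing_seqP => k /=.
apply: le_trans (am_step_descent K A (idx k) _ hS c0).
by rewrite lerDl mulr_ge0 ?sqr_ge0 // ltW.
Qed.

(** Every single step of the sweep lowers the objective by no more than the
    whole sweep does, hence has length at most [d]; the triangle inequality for
    [colsum] adds up the steps. *)
Lemma am_iter_drift (R : realType) (n r m : nat) (Sigma : 'M[R]_n)
    (K : 'M[R]_(n, r)) (A : 'M[R]_(m, n)) (s : R) (idx : nat -> 'I_m)
    (X0 : 'M[R]_(r, m)) (X := am_iter Sigma K A s idx X0) (a N k : nat) (d : R) :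
  spd Sigma -> 0 < s ^+ 2 -> 0 <= d ->
  F Sigma K A s (X a) - F Sigma K A s (X (a + N)%N) <= s ^+ 2 * d ^+ 2 ->
  (k <= N)%N -> colsum (X (a + N)%N - X (a + k)%N) <= N%:R * d.
Proof.
move=> hS c0 d0 hd kN.
have mono := am_iter_nonincreasing K A idx X0 hS c0.
have step j : (j < N)%N -> colsum (X (a + j).+1 - X (a + j)%N) <= d.
  move=> jN; rewrite -(ler_pXn2r (n := 2)) ?nnegrE ?colsum_ge0 //.
  rewrite -(ler_pM2l c0); apply: le_trans hd.
  rewrite -colsumN opprB.
  have := am_step_descent K A (idx (a + j)%N) (X (a + j)%N) hS c0.
  have h1 := mono _ _ (leq_addr j a).
  have h2 : F Sigma K A s (X (a + N)%N) <= F Sigma K A s (X (a + j).+1).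
    by apply: mono; rewrite -addnS leq_add2l.
  rewrite -/X /= in h1; rewrite -[am_step _ _ _ _ _ _]/(X (a + j).+1).
  lra.
rewrite -{1}(subnKC kN) addnA.
apply: (@le_trans _ _ ((N - k)%:R * d)); last first.
  by rewrite ler_wpM2r // ler_nat leq_subr.
have : (k + (N - k) <= N)%N by rewrite subnKC.
elim: (N - k)%N => [|p IHp] kp.
  rewrite addn0 subrr mul0r /colsum big1 // => i _.
  by rewrite linear0 enorm0.
rewrite -(subrKA (X (a + k + p)%N)); apply: le_trans (colsumD _ _) _.
rewrite -natr1 mulrDl mul1r addrC; apply: lerD.
  by apply: IHp; apply: leq_trans kp; rewrite addnS.
by rewrite addnS -addnA; apply: step; rewrite -addnS.
Qed.

Lemma am_iter_col_const (R : realType) (n r m : nat) (Sigma : 'M[R]_n)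
    (K : 'M[R]_(n, r)) (A : 'M[R]_(m, n)) (s : R) (idx : nat -> 'I_m)
    (X0 : 'M[R]_(r, m)) (X := am_iter Sigma K A s idx X0) (i : 'I_m) (k p : nat) :
  (forall l, (k <= l < k + p)%N -> idx l != i) ->
  col i (X (k + p)%N) = col i (X k).
Proof.
elim: p => [|p IHp] h; first by rewrite addn0.
rewrite addnS /X /= col_am_step ifN_eq; last first.
  by rewrite eq_sym h // leq_addr addnS leqnn.
apply: IHp => l /andP[kl lp]; apply: h; rewrite kl addnS ltnS; exact: ltnW.
Qed.

(** At the last visit to column [i] the optimality condition holds exactly with
    some subgradient [u i].  That column does not change until the end of the
    sweep, so [u i] remains a subgradient there, and the condition is violated
    by at most [e] because [halfgrad] and [colsum] are Lipschitz and the iterate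
    has drifted by at most [N d].  The subgradient inequality with these [u i]
    and the Cauchy-Schwarz inequality turn the violation into a gap. *)
Lemma sweep_gap (R : realType) (n r m : nat) (Sigma : 'M[R]_n)
    (K : 'M[R]_(n, r)) (A : 'M[R]_(m, n)) (s : R) (idx : nat -> 'I_m)
    (X0 Z : 'M[R]_(r, m)) (X := am_iter Sigma K A s idx X0) (a N : nat) (d : R)
    (b := \sum_k \sum_j `|(A *m Sigma *m A^T) k j|) :
  spd Sigma -> 0 < s ^+ 2 -> 0 <= d ->
  F Sigma K A s (X a) - F Sigma K A s (X (a + N)%N) <= s ^+ 2 * d ^+ 2 ->
  (forall i, exists k, [/\ (k < N)%N, idx (a + k)%N = i &
     forall l, (k < l < N)%N -> idx (a + l)%N != i]) ->
  F Sigma K A s (X (a + N)%N)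
  <= F Sigma K A s Z + 2 * ((b + s ^+ 2) * (N%:R * d)) * colsum (Z - X (a + N)%N).
Proof.
move=> hS c0 d0 hd visit; set X' := X (a + N)%N; set e := _ * (N%:R * d).
have b0 : 0 <= b by apply: sumr_ge0 => k _; exact: sumr_ge0.
have /fin_all_exists[u hu] : forall i, exists u, subgrad u (col i X') /\
    enorm (col i (halfgrad Sigma K A X') + (s ^+ 2 * colsum X') *: u) <= e.
  move=> i; have [k [kN ki last]] := visit i.
  have [u hu] := am_step_optimal K A (idx (a + k)%N) (X (a + k)%N) hS c0.
  rewrite -[am_step _ _ _ _ _ _]/(X (a + k).+1) ki => opt.
  set Xk := X (a + k).+1 in hu opt.
  have colX : col i X' = col i Xk.
    rewrite /X' -(subnKC kN) addnA addnS -addSn /Xk.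
    apply: am_iter_col_const => l /andP[kl lN].
    rewrite -(subnKC (ltnW kl : a + k <= l)%N) -addnA last //.
    by move: kl lN kN; lia.
  have drift : colsum (X' - Xk) <= N%:R * d.
    by rewrite /Xk -addnS; apply: am_iter_drift.
  exists u; split; first by rewrite colX -ki.
  have -> : col i (halfgrad Sigma K A X') + (s ^+ 2 * colsum X') *: u
    = col i ((X' - Xk) *m (A *m Sigma *m A^T))
      + (s ^+ 2 * (colsum X' - colsum Xk)) *: u.
    rewrite -[LHS]subr0 -opt mulrBr scalerBl opprD addrACA; congr (_ + _).
    rewrite -linearB; congr col; rewrite /halfgrad -!mulmxBl !mulmxA.
    by congr (_ *m _ *m _); rewrite opprD addrACA subrr addr0 mulmxBl.
  apply: le_trans (enormD _ _) _; rewrite /e mulrDl; apply: lerD.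
    apply: le_trans (enorm_col_mul _ _ _) _; exact: ler_wpM2l.
  rewrite enormZ normrM gtr0_norm // -mulrA (ler_pM2l c0).
  apply: (@le_trans _ _ `|colsum X' - colsum Xk|).
    by rewrite ler_piMr // hu.1.
  exact: le_trans (colsum_dist _ _) drift.
have := F_subgradient_ineq K A s Z hS (fun i => (hu i).1).
rewrite -lerBrDr => /le_trans; apply; rewrite -mulrN -mulrA lerD2l.
rewrite ler_pM2l // -sumrN [e * _]mulr_sumr; apply: ler_sum => i _.
rewrite -mulN1r -dotZl scaleN1r; apply: le_trans (dot_le_enorm _ _) _.
by rewrite enormN ler_wpM2r ?enorm_ge0 // (hu i).2.
Qed.

(** The limit [l] of [f] exists by monotonicity; passing to the limit in the
    hypothesis gives [(l - rho) ^+ 2 <= C (l - l) = 0]. *)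
Lemma cvg_of_sweep_decrease (R : realType) (f : nat -> R) (rho C : R) (N : nat) :
  (0 < N)%N -> nonincreasing_seq f -> (forall k, rho <= f k) ->
  (forall q,
    (f (q * N + N)%N - rho) ^+ 2 <= C * (f (q * N)%N - f (q * N + N)%N)) ->
  f k @[k --> \oo] --> rho.
Proof.
move=> N0 mono lb hq.
have cvf : cvgn f.
  apply: nonincreasing_is_cvgn => //; exists rho => _ [k _ <-]; exact: lb.
pose l : R := limn f.
have fl : f k @[k --> \oo] --> l by exact: cvf.
have toinf : (q * N)%N @[q --> \oo] --> \oo.
  exact: cvg_mulnr.
have g1 : f (q * N)%N @[q --> \oo] --> l by exact: (cvg_comp _ _ toinf fl).
have g2 : f (q * N + N)%N @[q --> \oo] --> l.
  exact: (cvg_comp _ _ toinf (cvg_comp _ _ (cvg_addnr N) fl)).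
suff <- : l = rho by [].
apply/eqP; rewrite -subr_eq0 -sqrf_eq0 eq_le sqr_ge0 andbT.
have h0 : C * (f (q * N)%N - f (q * N + N)%N) @[q --> \oo] --> C * (l - l).
  by apply: cvgMr; apply: cvgB.
have h1 : (f (q * N + N)%N - rho) ^+ 2 @[q --> \oo] --> (l - rho) ^+ 2.
  have h : (f (q * N + N)%N - rho) @[q --> \oo] --> l - rho.
    by apply: cvgB g2 _; exact: cvg_cst.
  exact: (cvgM h h).
rewrite -(mulr0 C) -(subrr l).
apply: (ler_cvg_to h1 h0); exact: nearW.
Qed.

(** * Existence of a minimizer *)

Lemma continuous_ext (T U : topologicalType) (f g : T -> U) :
  f =1 g -> continuous f -> continuous g.
Proof. by move=> /funext ->. Qed.

Lemma continuous_sum (R : realType) (T : topologicalType) (I : finType)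
    (f : I -> T -> R) :
  (forall i, continuous (f i)) -> continuous (fun x => \sum_i f i x).
Proof.
by move=> cf; apply: continuous_big => [|i _]; [exact: add_continuous|exact: cf].
Qed.

Lemma continuous_sqr (R : realType) (T : topologicalType) (f : T -> R) :
  continuous f -> continuous (fun x => f x ^+ 2).
Proof. by move=> cf x; exact: (cvgM (cf x) (cf x)). Qed.

Lemma continuous_sqrt_sum_sqr (R : realType) (T : topologicalType) (I : finType)
    (f : I -> T -> R) :
  (forall i, continuous (f i)) ->
  continuous (fun x => Num.sqrt (\sum_i f i x ^+ 2)).
Proof.
move=> cf x.
apply: (continuous_comp (g := Num.sqrt)); last exact: sqrt_continuous.
by apply: continuous_sum => i; exact: continuous_sqr.
Qed.

Lemma continuous_F_vec_mx (R : realType) (n r m : nat) (Sigma : 'M[R]_n)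
    (K : 'M[R]_(n, r)) (A : 'M[R]_(m, n)) (s : R) :
  continuous (fun v : 'rV[R]_(r * m) => F Sigma K A s (vec_mx v)).
Proof.
have entry i j :
    continuous (fun v : 'rV[R]_(r * m) => (vec_mx v : 'M_(r, m)) i j).
  apply: continuous_ext (@coord_continuous R 1 (r * m) 0 (mxvec_index i j)).
  by move=> v; rewrite mxE.
have mulE (p q : nat) (G : 'rV[R]_(r * m) -> 'M[R]_(r, p)) (B : 'M[R]_(p, q)) :
    (forall i j, continuous (fun v => G v i j)) ->
    forall i j, continuous (fun v => (G v *m B) i j).
  move=> cG i j.
  apply: (continuous_ext (f := fun v => \sum_k G v i k * B k j)).
    by move=> v; rewrite mxE.
  apply: continuous_sum => k v.
  exact: cvgM (cG i k v) (cvg_cst _).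
have res i j :
    continuous (fun v : 'rV[R]_(r * m) => (vec_mx v *m A - K^T) i j).
  have h : continuous (fun v : 'rV[R]_(r * m) =>
      (vec_mx v *m A) i j + (- K^T) i j : R).
    by move=> v; exact: cvgD (mulE _ _ _ A entry i j v) (cvg_cst _).
  by apply: continuous_ext h => v; rewrite [RHS]mxE.
have cfit : continuous (fun v : 'rV[R]_(r * m) =>
    fnorm ((vec_mx v *m A - K^T) *m sqrtm Sigma) : R).
  move=> v; apply: (continuous_comp (g := Num.sqrt)); last exact: sqrt_continuous.
  apply: continuous_sum => i; apply: continuous_sum => j; apply: continuous_sqr.
  exact: mulE.
have ccol : continuous (fun v : 'rV[R]_(r * m) =>
    \sum_(i < m) enorm (col i (vec_mx v)) : R).
  apply: continuous_sum => i; apply: continuous_sqrt_sum_sqr => l.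
  apply: continuous_ext (entry l i) => w. by rewrite [RHS]mxE.
move=> v; have h1 := @continuous_sqr _ _ _ cfit v.
have h2 : s ^+ 2 * (\sum_(i < m) enorm (col i (vec_mx w))) ^+ 2 @[w --> v] -->
    s ^+ 2 * (\sum_(i < m) enorm (col i (vec_mx v))) ^+ 2.
  exact: cvgM (cvg_cst _) (@continuous_sqr _ _ _ ccol v).
exact: cvgD h1 h2.
Qed.

(** The extreme value theorem, applied to the objective read on row vectors of
    length [r * m], on the sublevel set of the zero matrix; that set is bounded
    because the penalty is coercive. *)
Lemma F_attains_min (R : realType) (n r m : nat) (Sigma : 'M[R]_n)
    (K : 'M[R]_(n, r)) (A : 'M[R]_(m, n)) (s : R) :
  0 < s ^+ 2 -> exists Z, forall X, F Sigma K A s Z <= F Sigma K A s X.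
Proof.
move=> c0; pose f (v : 'rV[R]_(r * m)) := F Sigma K A s (vec_mx v).
have cf : continuous f by exact: continuous_F_vec_mx.
pose S := [set v | f v <= f 0].
have S0 : S !=set0 by exists 0; rewrite /S /=.
have cS : compact S.
  apply: bounded_closed_compact; last first.
    by move/continuous_closedP: cf => /(_ _ (@closed_le _ (f 0))).
  (* F bounds s^2 colsum^2, and colsum bounds the modulus of every entry. *)
  pose M := Num.sqrt (f 0 / s ^+ 2).
  exists M; split; first exact: num_real.
  move=> y My v Sv; apply: le_trans (ltW My).
  rewrite /Num.norm /= mx_normrE; apply/bigmax_leP; split=> [|[i j] _ /=].
    exact: sqrtr_ge0.
  rewrite (ord1 i); case/mxvec_indexP: j => k j.
  have -> : v 0 (mxvec_index k j) = (col j (vec_mx v)) k 0 by rewrite !mxE.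
  apply: le_trans (coord_le_enorm _ _) _.
  apply: (@le_trans _ _ (colsum (vec_mx v))).
    by rewrite (colsumD1 _ j) lerDl sumr_ge0 // => l _; exact: enorm_ge0.
  rewrite /M -(ger0_norm (colsum_ge0 _)) -sqrtr_sqr ler_wsqrtr //.
  rewrite ler_pdivlMr // mulrC; apply: le_trans Sv; exact: F_ge_colsum.
have [v vS vmin] := EVT_min_rV S0 cS (continuous_subspaceT cf).
exists (vec_mx v) => X; rewrite -[X]mxvecK; set w := mxvec X.
have [wS|/ltW wS] := leP (f w) (f 0); first by apply: vmin; rewrite inE.
by apply: le_trans wS; move: vS; rewrite inE.
Qed.

Unset Implicit Arguments.

(** * Convergence *)

Theorem proposition4p2 (R : realType) (n r m : nat) (Sigma : 'M[R]_n)
    (K : 'M[R]_(n, r)) (A : 'M[R]_(m, n)) (sigmaN : R)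
    (hSigma : spd Sigma) (hsigmaN : 0 < sigmaN ^+ 2) :
  exists2 rho : R, is_min (F Sigma K A sigmaN) rho &
    forall (X0 : 'M[R]_(r, m)) (idx : nat -> 'I_m),
      cyclic_order idx \/ permutation_order idx ->
      let X := am_iter Sigma K A sigmaN idx X0 in
      nonincreasing_seq (fun k => F Sigma K A sigmaN (X k))
      /\ F Sigma K A sigmaN (X k) @[k --> \oo] --> rho.
Proof.
have [Z Zmin] := F_attains_min Sigma K A hsigmaN.
exists (F Sigma K A sigmaN Z); first by split=> //; exists Z.
move=> X0 idx order X.
(* A cyclic order draws the same permutation for every group. *)
have [p hp] : permutation_order idx.
  by case: order => // -[p hp]; exists (fun=> p).
have mono := am_iter_nonincreasing K A idx X0 hSigma hsigmaN.
split; first exact: mono.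
set c := sigmaN ^+ 2 in hsigmaN.
pose f k := F Sigma K A sigmaN (X k).
pose b := \sum_k \sum_j `|(A *m Sigma *m A^T) k j|.
have b0 : 0 <= b by apply: sumr_ge0 => k _; exact: sumr_ge0.
(* T bounds the distance of all iterates to the minimizer, by coercivity. *)
pose T := colsum Z + Num.sqrt (F Sigma K A sigmaN X0 / c).
pose M := 2 * ((b + c) * m%:R) * T.
have colT k : colsum (Z - X k) <= T.
  apply: le_trans (colsumD _ _) _; rewrite colsumN lerD2l.
  rewrite -(ger0_norm (colsum_ge0 _)) -sqrtr_sqr ler_wsqrtr //.
  rewrite ler_pdivlMr // mulrC.
  exact: le_trans (F_ge_colsum Sigma K A _ _) (mono _ _ (leq0n k)).
have m0 : (0 < m)%N by apply: leq_ltn_trans (ltn_ord (idx 0%N)).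
apply: (@cvg_of_sweep_decrease _ _ _ (M ^+ 2 / c) m m0 mono) => // q.
rewrite -!/(f _).
set D := f _ - f (q * m + m)%N.
have D0 : 0 <= D by rewrite subr_ge0; apply: mono; exact: leq_addr.
(* With this d the sweep lowers the objective by exactly c d^2. *)
pose d := Num.sqrt (D / c).
have d0 : 0 <= d by exact: sqrtr_ge0.
have cd : c * d ^+ 2 = D.
  by rewrite sqr_sqrtr ?divr_ge0 ?(ltW hsigmaN) // mulrCA divff ?mulr1 // gt_eqF.
have visit i : exists k, [/\ (k < m)%N, idx (q * m + k)%N = i &
     forall l, (k < l < m)%N -> idx (q * m + l)%N != i].
  exists ((p q)^-1%g i); split=> [//||l /andP[kl lm]]; first by rewrite hp permKV.
  rewrite (hp q (Ordinal lm)); apply: contraTneq kl => <-.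
  by rewrite permK ltnn.
have gap : f (q * m + m)%N - F Sigma K A sigmaN Z <= M * d.
  have hD : D <= c * d ^+ 2 by rewrite cd.
  rewrite lerBlDl; apply: le_trans (sweep_gap Z hSigma hsigmaN d0 hD visit) _.
  rewrite lerD2l /M [leRHS]mulrAC -/b -/c (mulrA (b + c)) (mulrA 2) ler_wpM2l //.
  by rewrite !mulr_ge0 ?addr_ge0 // ltW.
have gap0 : 0 <= f (q * m + m)%N - F Sigma K A sigmaN Z.
  by rewrite subr_ge0; exact: Zmin.
rewrite -cd mulrA divfK ?gt_eqF // -exprMn ler_pXn2r ?nnegrE //.
exact: le_trans gap0 gap.
Qed.
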